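(* Let $\mathcal P$ be a finite set of points in $\mathbb R^2$ with the Euclidean metric, and let $G=(\mathcal P,E)$ be an undirected network in which every agent is greedy connected and whose number of edges is minimum among all such networks on $\mathcal P$ (a social optimum network). Then there is an assignment of each edge of $E$ to exactly one of its endpoints as owner such that the resulting strategy profile of the undirected greedy routing network creation game is a $2$-additive Nash equilibrium.
   Context: Undirected variant of the game: $\mathcal P$ is a finite set of points (agents) with metric $d$; each agent $u$ chooses a strategy $S_u\subseteq\{\{u,v\}:v\in\mathcal P\setminus\{u\}\}$ of undirected edges, which it owns; a profile $\mathbf s$ induces the network $G(\mathbf s)$ on $\mathcal P$ in which $\{u,v\}$ is an edge iff $\{u,v\}\in S_u\cup S_v$. A greedy routing path from $u$ to $w$ is a path $(x_1=u,\dots,x_j=w)$ in the network with $d(x_i,w)>d(x_{i+1},w)$ for all $i$; $u$ is greedy connected if it has a greedy routing path to every other agent. The cost of $u$ is $c_u(\mathbf s)=|S_u|$ if $u$ is greedy connected and $\infty$ otherwise. A profile $\mathbf s$ is a $\gamma$-additive Nash equilibrium if no agent $u$ can, by unilaterally changing its strategy, obtain cost strictly less than $c_u(\mathbf s)-\gamma$. *)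

(* Defs.v *)
From HB Require Import structures.
From mathcomp Require Import all_boot all_order all_algebra.
From mathcomp Require Import boolp reals.
Set Implicit Arguments. Unset Strict Implicit. Unset Printing Implicit Defensive.
Import Order.TTheory GRing.Theory Num.Theory.
Local Open Scope ring_scope.

Section GreedyGame.
Variables (R : realType) (T : finType) (pos : T -> R * R).

Definition edist (u v : T) : R :=
  Num.sqrt (((pos u).1 - (pos v).1) ^+ 2 + ((pos u).2 - (pos v).2) ^+ 2).

Definition greedy_path (adj : rel T) (u w : T) : Prop :=
  exists s : seq T,
    path (fun x y => adj x y && (edist y w < edist x w)) u s /\ last u s = w.

Definition greedy_connected (adj : rel T) (u : T) : Prop :=
  forall w, w != u -> greedy_path adj u w.

Definition wf_edges (E : {set {set T}}) : Prop :=
  forall e, e \in E -> #|e| = 2%N.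

Definition adjE (E : {set {set T}}) : rel T :=
  fun x y => (x != y) && ([set x; y] \in E).

Definition social_optimum (E : {set {set T}}) : Prop :=
  [/\ wf_edges E,
      (forall u, greedy_connected (adjE E) u) &
      (forall E', wf_edges E' -> (forall u, greedy_connected (adjE E') u) ->
         (#|E| <= #|E'|)%N)].

(* Strategy profiles: s u is the set of partners v such that u owns the
   edge {u,v}; so S_u = {{u,v} : v \in s u}, and |S_u| = #|s u|. *)
Definition valid_strategy (u : T) (S : {set T}) : Prop := u \notin S.

Definition valid_profile (s : T -> {set T}) : Prop :=
  forall u, valid_strategy u (s u).

Definition netP (s : T -> {set T}) : rel T :=
  fun x y => (y \in s x) || (x \in s y).

(* Cost: |S_u| if u greedy connected, infinity (None) otherwise. *)
Definition cost (s : T -> {set T}) (u : T) : option nat :=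
  if `[< greedy_connected (netP s) u >] then Some #|s u| else None.

Definition update (s : T -> {set T}) (u : T) (S : {set T}) : T -> {set T} :=
  fun x => if x == u then S else s x.

(* new cost strictly less than old cost minus gamma (infinity - gamma = infinity) *)
Definition strictly_better (gamma : R) (cnew cold : option nat) : Prop :=
  match cnew, cold with
  | Some a, Some b => a%:R < b%:R - gamma
  | Some _, None => True
  | None, _ => False
  end.

Definition additive_NE (gamma : R) (s : T -> {set T}) : Prop :=
  forall u (S : {set T}), valid_strategy u S ->
    ~ strictly_better gamma (cost (update s u S) u) (cost s u).

End GreedyGame.

(* Main.v *)
Require Import Defs.
From HB Require Import structures.
From mathcomp Require Import all_boot all_order all_algebra.
From mathcomp Require Import boolp reals.
From mathcomp Require Import ring lra zify.
Set Implicit Arguments. Unset Strict Implicit. Unset Printing Implicit Defensive.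

(** All agents are greedy connected iff every u has, for every w, a neighbour closer to w
    than u; call such a neighbourhood of u covering. If v in X is closer to w than u in X,
    then so is some Delaunay neighbour of u in X. Hence the edges of an optimum E inside X
    can be exchanged for a Delaunay graph of X, which has fewer than 3|X| edges, and E has
    an orientation D of outdegree at most 3.

    The owner u of D u can only gain more than 2 if |D u| = 3 and u is covered without D u.
    Such a u passes one edge of D u on to its head h. The head is no worse off, unless h can
    pay for its received edges by the same number of new edges and then also drop D h; in
    that case h passes on an edge of D h in turn. An acyclic such process with as few stuck
    vertices as possible has none: the vertices that can be stuck form a set X closed under
    D with |D u| = 3 on X, so that X would span 3|X| edges. In the final ownership, a
    deviation of v that saves more than 2 edges could be combined with the replacements at
    the vertices whose passes lead to v, giving a network smaller than E. *)

(** * Sparse graphs and orientations *)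

Section Orientation.
Variable T : finType.
Implicit Types (u v h : T) (E : {set {set T}}) (X : {set T}) (D : {ffun T -> {set T}}).

Definition nbr E u : {set T} := [set v | (v != u) && ([set u; v] \in E)].

Definition induced E X : {set {set T}} := [set e in E | e \subset X].

Definition oriented E (D : T -> {set T}) : Prop :=
  [/\ forall u v, v \in D u -> v \in nbr E u,
      forall u v, v \in nbr E u -> (v \in D u) || (u \in D v) &
      forall u v, v \in D u -> u \notin D v].

Lemma nbr_sym E u v : (v \in nbr E u) = (u \in nbr E v).
Proof. by rewrite !inE eq_sym setUC. Qed.

Lemma set2_inj u v u' v' : [set u; v] = [set u'; v'] ->
  (u = u' /\ v = v') \/ (u = v' /\ v = u').
Proof.
move=> e; have := set21 u v; have := set22 u v; rewrite e !inE.
have := set21 u' v'; have := set22 u' v'; rewrite -e !inE.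
by do 4![case/orP => /eqP ?]; subst; auto.
Qed.

(** Sending an arc [(u, h)] to [[set u; h]] is injective because no edge is oriented both ways. *)
Lemma card_arcs E (D : T -> {set T}) X : oriented E D -> (forall u, u \in X -> D u \subset X) ->
  \sum_(u in X) #|D u| <= #|induced E X|.
Proof.
move=> [DE _ Danti] DX.
have -> : \sum_(u in X) #|D u| = #|[set p | (p.1 \in X) && (p.2 \in D p.1)]|.
  rewrite -sum1dep_card.
  under eq_bigr do rewrite -sum1_card.
  by rewrite pair_big_dep.
have inj : {in [set p | (p.1 \in X) && (p.2 \in D p.1)] &,
    injective (fun p : T * T => [set p.1; p.2])}.
  move=> [u h] [u' h']; rewrite !inE /= => /andP[_ hu] /andP[_ hu'].
  case/set2_inj => [[-> ->]//|[uh hu2]]; subst.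
  by have := Danti _ _ hu; rewrite hu'.
rewrite -(card_in_imset inj); apply/subset_leq_card/subsetP=> _ /imsetP[p pP ->].
have {pP} /andP[p1 p2] : (p.1 \in X) && (p.2 \in D p.1) by rewrite inE in pP.
have := DE _ _ p2; rewrite !inE => /andP[_ ->] /=.
by rewrite subUset !sub1set p1 (subsetP (DX _ p1)).
Qed.

Lemma oriented_exists E : exists D : {ffun T -> {set T}}, oriented E D.
Proof.
exists [ffun u => [set v in nbr E u | enum_rank u < enum_rank v]].
split=> u v; rewrite !ffunE.
- by rewrite inE => /andP[].
- move=> uv; have vu := uv; rewrite nbr_sym in vu; rewrite inE uv inE vu /=.
  move: uv; rewrite inE => /andP[vu' _].
  by rewrite -neq_ltn (inj_eq val_inj) (inj_eq enum_rank_inj) eq_sym.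
- by rewrite !inE => /andP[_ lt]; rewrite negb_and -leqNgt (ltnW lt) orbT.
Qed.

Definition flip D u h : {ffun T -> {set T}} :=
  [ffun a => if a == u then D u :\ h else if a == h then u |: D h else D a].

Lemma oriented_flip E D u h : oriented E D -> h \in D u -> oriented E (flip D u h).
Proof.
move=> [DE DE' Da] hu.
have uh : u != h by have := DE _ _ hu; rewrite inE eq_sym => /andP[].
have mem a b : (b \in flip D u h a) =
    ((b \in D a) && ((a, b) != (u, h))) || ((a, b) == (h, u)).
  rewrite ffunE; have [->|au] := eqVneq a u.
    by rewrite !inE !xpair_eqE eqxx (negbTE uh) /= orbF andbC.
  case: (eqVneq a h) au => [->|ah] au; rewrite ?inE !xpair_eqE ?eqxx ?(negbTE au) ?(negbTE ah) /=.
    by rewrite ?andbT orbC.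
  by rewrite ?andbT ?orbF.
split=> a b; rewrite !mem.
- case/orP => [/andP[/DE//]|/eqP[-> ->]]; by rewrite nbr_sym DE.
- move/DE'; rewrite !xpair_eqE => /orP[] ->;
  by case: (a =P u); case: (b =P h); case: (a =P h); case: (b =P u); rewrite ?orbT.
- case/orP => [/andP[ba ne]|/eqP[-> ->]].
    rewrite (negbTE (Da _ _ ba)) /=; apply: contra ne => /eqP[-> ->].
    by rewrite eqxx.
  by rewrite eqxx andbF orFb xpair_eqE (negbTE uh).
Qed.

(** Subtraction is truncated, so this potential vanishes exactly when all outdegrees are at most
    3. *)
Definition overload D := \sum_u (#|D u| - 3).

Lemma overload_flip E D u h : oriented E D -> h \in D u -> 3 < #|D u| ->
  overload (flip D u h) + (#|D h| < 3) = overload D.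
Proof.
move=> [DE _ Da] hu u3.
have uh : h != u by have := DE _ _ hu; rewrite inE => /andP[].
rewrite /overload (bigD1 u)// (bigD1 h)//= [in RHS](bigD1 u)// [in RHS](bigD1 h)//=.
rewrite !ffunE !eqxx (negbTE uh) cardsU1 (Da _ _ hu).
have := cardsD1 h (D u); rewrite hu => Du.
rewrite [X in _ + (_ + X) + _](eq_bigr (fun a => #|D a| - 3)); first
  by case: (ltnP #|D h| 3) => /= ?; rewrite !add1n in Du *; lia.
by move=> a /andP[au ah]; rewrite ffunE (negbTE au) (negbTE ah).
Qed.

(** Reversing the arcs of the path one after the other moves one unit of excess along it at constant
    overload; at a vertex of outdegree below 3 the unit would disappear, against minimality. *)
Lemma path_overload E m D u (p : seq T) :
  (forall D', oriented E D' -> m <= overload D') -> oriented E D -> overload D = m ->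
  3 < #|D u| -> path (fun a b => b \in D a) u p -> uniq (u :: p) ->
  3 <= #|D (last u p)|.
Proof.
move=> minm; elim: p D u => [|h p IH] D u oD Dm u3 /=; first by move=> _ _; apply: ltnW.
case/andP=> hu hp /and3P[]; rewrite inE negb_or => /andP[uh up] hp' up'.
have oF := oriented_flip oD hu; have := overload_flip oD hu u3.
have h3 : 3 <= #|D h|.
  rewrite leqNgt; apply/negP => h3; have := minm _ oF; have := overload_flip oD hu u3.
  by rewrite h3 Dm; lia.
rewrite ltnNge h3 addn0 Dm => Fm.
have Fh : flip D u h h = u |: D h by rewrite ffunE eq_sym (negbTE uh) eqxx.
have Fh3 : 3 < #|flip D u h h|.
  by case: oD => _ _ Da; rewrite Fh cardsU1 (Da _ _ hu).
have [->//|lh] := eqVneq (last h p) h.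
have lu : last h p != u.
  apply/eqP => e; have := mem_last h p; rewrite e inE (negbTE uh) /=.
  by rewrite (negbTE up).
have := IH _ _ oF Fm Fh3 _ _; rewrite ffunE (negbTE lu) (negbTE lh); apply.
  apply: (@sub_in_path _ (predC1 u) (fun a b => b \in D a)) hp.
    by move=> a b /= au bu ab; rewrite ffunE (negbTE au); case: eqP => [<-|//]; rewrite inE ab orbT.
  by rewrite /= eq_sym uh; apply/allP=> a ap /=; apply: contraNneq up => <-.
by rewrite /= hp'.
Qed.

(* Half of Hakimi's theorem: sparsity bounds the outdegree. *)
Lemma oriented_le3 E : (forall X, X != set0 -> #|induced E X| < 3 * #|X|) ->
  exists2 D : {ffun T -> {set T}}, oriented E D & forall u, #|D u| <= 3.
Proof.
move=> sparse; have [D0 oD0] := oriented_exists E.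
have P0 : [pred D : {ffun T -> {set T}} | `[< oriented E D >]] D0 by apply/asboolP.
case: (arg_minnP overload P0) => D /asboolP oD minD; exists D => // u.
rewrite leqNgt; apply/negP => u3.
(* [X] is closed under [D] and, by minimality, all its outdegrees are at least 3; so it spans too
   many edges. *)
pose e : rel T := fun a b => b \in D a; pose X := [set t | connect e u t].
have X3 t : t \in X -> 3 <= #|D t|.
  rewrite inE => /connectP[p /shortenP[p' pp' up' _] ->].
  by apply: (path_overload _ oD erefl u3 pp' up') => D' oD'; apply/minD/asboolP.
have uX : u \in X by rewrite inE connect0.
have X0 : X != set0 by apply/set0Pn; exists u.
have DX t : t \in X -> D t \subset X.
  rewrite inE => ut; apply/subsetP => h ht; rewrite inE (connect_trans ut)//.
  exact: connect1.
have := card_arcs oD DX; rewrite leqNgt => /negP; apply.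
apply: leq_trans (sparse _ X0) _.
rewrite mulnC -sum_nat_const; exact: leq_sum.
Qed.

End Orientation.

(** * Passing edges on *)

Section Picks.
Variables (T : finType) (cov : T -> {set T} -> bool) (E : {set {set T}}).
Variable D : {ffun T -> {set T}}.
Hypothesis cov_mono : forall u (A B : {set T}), A \subset B -> cov u A -> cov u B.
Hypothesis cov_D1 : forall u (A : {set T}), cov u A -> cov u (A :\ u).
Hypothesis oD : oriented E D.
Implicit Types (u v h x : T) (pk : {ffun T -> option T}) (S : {set T}).

(** [pk u = Some v] means that [u] passes its edge to [v] on to [v]; [None] means that [u] passes
    nothing. *)
Definition pickers pk v : {set T} := [set u | pk u == Some v].

Definition climbs pk : rel T := connect (fun a b => pk a == Some b).

(* v is active when, at the price of #|pickers pk v| new edges, it can do without all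
   the edges of D v and pickers pk v. *)
Definition active pk v : bool :=
  (#|D v| == 3) && [exists S : {set T},
    (#|S| <= #|pickers pk v|) && cov v (S :|: (nbr E v :\: (D v :|: pickers pk v)))].

Definition acyclic pk : Prop :=
  (forall v h, pk v = Some h -> h \in D v) /\
  (forall v h, pk v = Some h -> ~~ climbs pk h v).

Definition structure pk : Prop :=
  acyclic pk /\ forall v, pk v != None -> active pk v.

(** The stuck vertices: each is entitled to pass an edge but has not done so. *)
Definition pending pk : {set T} := [set v | active pk v && (pk v == None)].

(** Each additional picker raises the budget by one, which pays for buying back the edge to that
    picker. *)
Lemma active_mono pk pk' v : pickers pk v \subset pickers pk' v -> active pk v -> active pk' v.
Proof.
move=> JJ /andP[D3 /existsP[S /andP[SJ cS]]]; rewrite /active D3 /=.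
apply/existsP; exists (S :|: (pickers pk' v :\: pickers pk v)); apply/andP; split.
  rewrite (leq_trans (leq_card_setU _ _))// cardsD (setIidPr JJ).
  by have := subset_leq_card JJ; lia.
apply: cov_mono cS; apply/subsetP=> a; rewrite !(inE, negb_or).
case: (a \in S) => //=; case: (pk a == Some v); case: (pk' a == Some v); rewrite ?andbF ?andbT //=.
Qed.

Definition restrict pk (W : {set T}) : {ffun T -> option T} :=
  [ffun v => if v \in W then pk v else None].

Lemma pickers_restrict pk W v : pickers (restrict pk W) v = pickers pk v :&: W.
Proof. by apply/setP=> a; rewrite !inE ffunE; case: ifP; rewrite ?andbT ?andbF. Qed.

Lemma climbs0 pk v : climbs pk v v. Proof. exact: connect0. Qed.

Lemma climbs1 pk u v : pk u = Some v -> climbs pk u v.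
Proof. by move=> uv; apply: connect1; apply/eqP. Qed.

Lemma climbs_trans pk : transitive (climbs pk).
Proof. exact: connect_trans. Qed.

Lemma climbs_sub pk pk' : (forall a b, pk a = Some b -> pk' a = Some b) ->
  subrel (climbs pk) (climbs pk').
Proof.
by move=> sub; apply: connect_sub => a b /eqP/sub ab; apply: climbs1.
Qed.

Lemma acyclic_sub pk pk' : (forall a b, pk a = Some b -> pk' a = Some b) ->
  acyclic pk' -> acyclic pk.
Proof.
move=> sub [aD ac]; split=> v h /sub; first exact: aD.
by move/ac; apply: contra; apply: climbs_sub.
Qed.

Lemma restrict_some pk W a b : restrict pk W a = Some b -> pk a = Some b.
Proof. by rewrite ffunE; case: ifP. Qed.

(** [W] is the union of all vertex sets whose picks justify themselves; as [active] is monotone, [W]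
    does so too. A picking vertex still active outside [W] could be added to it, so pruning leaves
    no former picker stuck. *)
Lemma prune pk : acyclic pk -> exists W : {set T},
  [/\ structure (restrict pk W),
      forall v, v \in pending (restrict pk W) -> active pk v /\ pk v = None &
      forall W' : {set T}, (forall v, v \in W' -> pk v != None /\ active (restrict pk W') v) ->
        W' \subset W].
Proof.
move=> api.
pose good (W : {set T}) := [forall v in W, (pk v != None) && active (restrict pk W) v].
pose W : {set T} := \bigcup_(W' : {set T} | good W') W'.
have sub W' : good W' -> W' \subset W by move=> gW; apply: bigcup_sup.
have actW W' v : good W' -> active (restrict pk W') v -> active (restrict pk W) v.
  by move=> /sub sW; apply: active_mono; rewrite !pickers_restrict setIS.
have gW : good W.
  apply/forall_inP=> v /bigcupP[W' gW' vW'].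
  have /andP[-> a] := forall_inP gW' _ vW'; exact: actW a.
exists W; split.
- split; first exact: acyclic_sub (@restrict_some pk W) api.
  by move=> v; rewrite ffunE; case: ifP => // vW _; have /andP[] := forall_inP gW _ vW.
- move=> v; rewrite inE => /andP[av]; rewrite ffunE; case: ifP => vW.
    by move/eqP => pv; have /andP[] := forall_inP gW _ vW; rewrite pv.
  move=> _; split; first by apply: active_mono av; rewrite pickers_restrict subsetIl.
  apply/eqP; apply: contraFT vW => pv.
  have sW : W \subset v |: W by apply: subsetUr.
  have am a : active (restrict pk W) a -> active (restrict pk (v |: W)) a.
    by apply: active_mono; rewrite !pickers_restrict setIS.
  have /sub/subsetP : good (v |: W); last by apply; rewrite setU11.
  apply/forall_inP=> a /setU1P[->|aW]; first by rewrite pv am.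
  by have /andP[-> aa] := forall_inP gW _ aW; rewrite am.
- move=> W' gW'; apply: sub; apply/forall_inP=> v /gW'[-> ->] //.
Qed.

Lemma climbs_step pk u v : climbs pk u v -> u != v ->
  exists2 h, pk u = Some h & climbs pk h v.
Proof.
case/connectP=> [[|h p]] /=; first by move=> _ ->; rewrite eqxx.
by case/andP=> /eqP uh hp -> _; exists h => //; apply/connectP; exists p.
Qed.

Definition set_pick pk x h : {ffun T -> option T} :=
  [ffun v => if v == x then Some h else pk v].

(** Only [h] gains a picker, so activity persists and at most [h] becomes stuck in place of [x]. *)
Lemma extend pk x h : structure pk -> x \in pending pk -> h \in D x -> ~~ climbs pk h x ->
  [/\ structure (set_pick pk x h), pending (set_pick pk x h) \subset h |: (pending pk :\ x) &
      forall v, active pk v -> active (set_pick pk x h) v].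
Proof.
move=> [[piD ac] dom]; rewrite inE => /andP[ax /eqP px] hx nhx.
have Jsub v : pickers pk v \subset pickers (set_pick pk x h) v.
  by apply/subsetP=> a; rewrite !inE ffunE; case: (eqVneq a x) => // ->; rewrite px.
have am v : active pk v -> active (set_pick pk x h) v by apply: active_mono.
(* A path using the new pick yields an old path to [x] and an old path from [h]. *)
have cl a b : climbs (set_pick pk x h) a b ->
    climbs pk a b || (climbs pk a x && climbs pk h b).
  case/connectP=> p; elim: p a => [|c p IH] a /=; first by move=> _ ->; rewrite climbs0.
  rewrite ffunE => /andP[+ cp] bl; have {IH} := IH _ cp bl.
  have [->|ax'] := eqVneq a x; last first.
    move=> H /eqP/climbs1 ac'; case/orP: H => [cb|/andP[cx hb]].
      by rewrite (climbs_trans ac' cb).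
    by rewrite (climbs_trans ac' cx) hb orbT.
  move=> H /eqP[hc]; subst c; rewrite climbs0.
  by case/orP: H => [->|/andP[_ ->]]; rewrite orbT.
split=> //.
- split; [split=> v k|move=> v]; rewrite ffunE.
  + by case: (eqVneq v x) => [-> [<-]//|_]; apply: piD.
  + case: (eqVneq v x) => [-> [<-]|vx pv]; apply/negP => /cl.
      by rewrite (negbTE nhx).
    rewrite (negbTE (ac _ _ pv)) /= => /andP[kx hv]; case/negP: nhx.
    by apply: climbs_trans hv _; apply: climbs_trans kx; apply: climbs1.
  + by case: (eqVneq v x) => [->|_] H; apply: am => //; apply: dom.
- apply/subsetP => v; rewrite 4!inE !inE ffunE => /andP[av].
  case: (eqVneq v x) => // vx pv; have [//|vh /=] := eqVneq v h.
  rewrite pv andbT; apply: active_mono av; apply/subsetP=> a; rewrite !inE ffunE.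
  by case: (eqVneq a x) => // _ /eqP[] e; rewrite e eqxx in vh.
Qed.

Lemma exists_complete :
  (forall X, X != set0 -> #|induced E X| < 3 * #|X|) ->
  exists2 pk, structure pk & pending pk = set0.
Proof.
move=> sparse.
pose pk0 : {ffun T -> option T} := [ffun=> None].
have s0 : structure pk0.
  by split=> [|v]; [split=> v h|]; rewrite ffunE.
have P0 : [pred pk | `[< structure pk >]] pk0 by apply/asboolP.
case: (arg_minnP (fun pk => #|pending pk|) P0) => pk1 /asboolP s1 min1; exists pk1 => //.
have {}min1 pk : structure pk -> #|pending pk1| <= #|pending pk|.
  by move=> s; apply/min1/asboolP.
set m := #|pending pk1| in min1; apply/eqP; rewrite -cards_eq0 -/m; apply: contraT => m0.
(* Bounds the size of a set of [m.-1] elements joined with [h], whether or not [h] is new. *)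
have bm (b : bool) : b + m.-1 <= m.
  by rewrite -{2}(prednK (_ : 0 < m)) ?lt0n// -add1n leq_add2r leq_b1.
pose X := [set x | `[< exists pk, [/\ structure pk, x \in pending pk & #|pending pk| = m] >]].
have inX h pk : structure pk -> h \in pending pk -> #|pending pk| <= m -> h \in X.
  move=> spi hpi le; rewrite inE; apply/asboolP; exists pk; split=> //.
  by apply/eqP; rewrite eqn_leq le min1.
have X0 : X != set0.
  rewrite cards_eq0 in m0; case/set0Pn: m0 => x xp; apply/set0Pn; exists x.
  exact: inX xp (leqnn _).
have closed x : x \in X -> D x \subset X.
  rewrite inE => /asboolP[pk [spi xp pm]]; apply/subsetP => h hx.
  have pDx : #|pending pk :\ x| = m.-1 by have := cardsD1 x (pending pk); rewrite xp pm => ->.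
  have hxn : h != x by have [DE _ _] := oD; have := DE _ _ hx; rewrite inE => /andP[].
  (* If the picks climb from h to x, letting x pick h would close a cycle:
     leave h without a pick instead, and prune the picks this makes unnecessary. *)
  have [hcx|nhx] := boolP (climbs pk h x); last first.
    (* [x] is no longer stuck, so by minimality [h] has to be. *)
    have [s' p' _] := extend spi xp hx nhx.
    have hp : h \in pending (set_pick pk x h).
      apply: contraT => hp; have := min1 _ s'.
      have /subset_leq_card : pending (set_pick pk x h) \subset pending pk :\ x.
        apply/subsetP=> a ap; have := subsetP p' _ ap; rewrite in_setU1.
        by case/orP => // /eqP ah; rewrite ah (negbTE hp) in ap.
      by rewrite pDx => /(leq_trans _)/[apply]; rewrite leqNgt prednK ?lt0n// leqnn.
    apply: inX s' hp _; apply: leq_trans (subset_leq_card p') _.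
    by rewrite cardsU1 pDx.
  have [g hg gx] := climbs_step hcx hxn.
  have [[piD ac] dom] := spi.
  pose pk' : {ffun T -> option T} := [ffun v => if v == h then None else pk v].
  have pi's a b : pk' a = Some b -> pk a = Some b by rewrite ffunE; case: ifP.
  have [W [sW pW gW]] := prune (acyclic_sub pi's (conj piD ac)).
  have ahJ a b : climbs pk b h -> a \in pickers pk b -> a != h /\ climbs pk a h.
    rewrite inE => bh /eqP ab; split; last first.
      by apply: climbs_trans bh; apply: climbs1.
    by apply: contraTneq bh => <-; apply: ac.
  (* The pickers of a vertex climbing to [h] climb to [h] too and, by acyclicity, differ from [h].
     So these picks justify themselves, survive the pruning, and keep [h] active. *)
  have Wanc : [set u | (u != h) && climbs pk u h] \subset W.
    apply: gW => v; rewrite inE => /andP[vh vch].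
    have [k vk _] := climbs_step vch vh.
    split; first by rewrite ffunE (negbTE vh) vk.
    apply: active_mono (dom v _); last by rewrite vk.
    apply/subsetP=> a av; have [ah ach] := ahJ _ _ vch av.
    by rewrite pickers_restrict !inE ffunE (negbTE ah) ach; rewrite inE in av; rewrite av.
  have ah : active (restrict pk' W) h.
    apply: active_mono (dom h _); last by rewrite hg.
    apply/subsetP=> a av; have [ah ach] := ahJ _ _ (climbs0 _ _) av.
    rewrite pickers_restrict inE (subsetP Wanc) ?inE ?ah// andbT.
    by rewrite ffunE (negbTE ah); rewrite inE in av.
  have Wh : restrict pk' W h = None by rewrite !ffunE eqxx; case: ifP.
  have hp : h \in pending (restrict pk' W) by rewrite inE ah Wh.
  have psub : pending (restrict pk' W) \subset h |: pending pk.
    apply/subsetP=> v /pW[av]; rewrite ffunE !inE; case: eqP => //= _ pv.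
    rewrite pv andbT; apply: active_mono av; apply/subsetP=> a; rewrite !inE => /eqP/pi's ->.
    by rewrite eqxx.
  (* Only [h] can be newly stuck. If [x] still is stuck, it can now pick [h], from which no pick
     leads on; either way [x] makes room for [h] in the count. *)
  have [xp'|xp'] := boolP (x \in pending (restrict pk' W)); last first.
    apply: inX sW hp _.
    have /subset_leq_card : pending (restrict pk' W) \subset h |: (pending pk :\ x).
      apply/subsetP=> a ap; have := subsetP psub _ ap; rewrite !in_setU1 in_setD1.
      by have -> : a != x by apply: contraNneq xp' => <-.
    by move/leq_trans; apply; rewrite cardsU1 pDx.
  have nhx : ~~ climbs (restrict pk' W) h x.
    by apply/negP => /climbs_step/(_ hxn)[k]; rewrite Wh.
  have [s' p' am] := extend sW xp' hx nhx.
  apply: inX s' _ _; first by rewrite inE am// ffunE (negbTE hxn) Wh.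
  have /subset_leq_card/leq_trans : pending (set_pick (restrict pk' W) x h) \subset h |: (pending pk :\ x).
    apply/subsetP=> a ap; have := subsetP p' _ ap; rewrite !in_setU1 in_setD1.
    case/orP => [->//|/andP[ax' /(subsetP psub)]]; rewrite in_setU1 in_setD1 ax' => /orP[->//|->].
    by rewrite orbT.
  by apply; rewrite cardsU1 pDx.
have X3 x : x \in X -> #|D x| = 3.
  rewrite inE => /asboolP[pk [_ + _]]; rewrite inE => /andP[/andP[/eqP-> _] _] //.
have := card_arcs oD closed; rewrite (eq_bigr (fun=> 3)) ?sum_nat_const; last exact: X3.
by rewrite mulnC leqNgt sparse.
Qed.

(** * Exchanges in a minimum network and the final ownership *)

Hypothesis wfE : forall e, e \in E -> #|e| = 2.
Hypothesis covE : forall u, cov u (nbr E u).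
Hypothesis minE : forall E' : {set {set T}}, (forall e, e \in E' -> #|e| = 2) ->
  (forall u, cov u (nbr E' u)) -> #|E| <= #|E'|.

(* Delete the picked edges of all u from which the picks climb to v, and let v buy S
   and each such u its replacement set. *)
Lemma exchange pk v S : structure pk ->
  cov v (S :|: (nbr E v :\: pickers pk v)) -> #|pickers pk v| <= #|S|.
Proof.
move=> [[piD ac] dom] cS.
have [DE _ Da] := oD.
pose A := [set u | (u != v) && climbs pk u v].
have HF u : exists F : {set T}, u \in A ->
    #|F| <= #|pickers pk u| /\ cov u (F :|: (nbr E u :\: (D u :|: pickers pk u))).
  case: (boolP (u \in A)) => [|_]; last by exists set0.
  rewrite inE => /andP[uv cl]; have [h uh _] := climbs_step cl uv.
  have /andP[_ /existsP[F /andP[F1 F2]]] : active pk u by apply: dom; rewrite uh.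
  by exists F.
have [F FP] := choice HF.
(* The default [v] is never taken on [A], where every vertex has a pick. *)
pose hd u := odflt v (pk u).
have hdP u : u \in A -> pk u = Some (hd u).
  by rewrite inE => /andP[uv cl]; have [h uh _] := climbs_step cl uv; rewrite /hd uh.
pose star u B : {set {set T}} := [set [set u; w] | w in B :\ u].
pose del : {set {set T}} := [set [set u; hd u] | u in A].
pose G := (E :\: del) :|: ((\bigcup_(u in A) star u (F u)) :|: star v S).
have cstar u B : #|star u B| <= #|B|.
  by rewrite (leq_trans (leq_imset_card _ _))// subset_leq_card// subsetDl.
have hdD u : u \in A -> hd u \in D u by move=> uA; apply: piD; apply: hdP.
have cdel : #|del| = #|A|.
  apply: card_in_imset => a b aA bA /set2_inj[[]//|[ab ba]].
  by have := Da _ _ (hdD _ aA); rewrite ba ab hdD.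
have JA u : u \in v |: A -> pickers pk u \subset A.
  move=> uA; have uv : climbs pk u v.
    by case/setU1P: uA => [->|]; [exact: climbs0|rewrite inE => /andP[]].
  apply/subsetP=> a; rewrite inE => /eqP au; rewrite inE (climbs_trans (climbs1 au) uv) andbT.
  by apply: contraTneq uv => av; apply: ac; rewrite -av.
(* Each vertex of [A] picks only once, so the sets of pickers over [v |: A] are disjoint; they all
   lie in [A]. *)
have sumJ : #|pickers pk v| + \sum_(u in A) #|pickers pk u| <= #|A|.
  have vA : v \notin A by rewrite inE eqxx.
  rewrite -(big_setU1 _ vA) /=.
  have cJ u : u \in v |: A -> #|pickers pk u| = \sum_(a in A | pk a == Some u) 1.
    move=> uA; rewrite sum1dep_card; apply: eq_card => a; have H := subsetP (JA _ uA) a.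
    rewrite [a \in pickers pk u]inE in H *; rewrite [RHS]inE; apply/idP/andP => [au|[_ ->]//].
    by split=> //; apply: H.
  rewrite (eq_bigr _ cJ) (exchange_big_dep (fun a => a \in A)) => [|u a _ /andP[]//].
  rewrite -sum1_card; apply: leq_sum => a aA; rewrite sum1dep_card.
  rewrite -(cards1 (hd a)) subset_leq_card//; apply/subsetP=> u; rewrite !inE.
  by case/and3P=> _ _; rewrite (hdP _ aA) => /eqP[->].
(* The deletions save [#|A|] edges; the purchases cost at most [#|S|] plus the number of pickers of
   vertices of [A]. *)
have cG : #|G| + #|pickers pk v| <= #|E| + #|S|.
  have dE : del \subset E.
    apply/subsetP=> _ /imsetP[u uA ->].
    by have := DE _ _ (hdD _ uA); rewrite inE => /andP[].
  have g1 : #|G| <= #|E :\: del| + #|(\bigcup_(u in A) star u (F u)) :|: star v S|.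
    exact: leq_card_setU.
  have g2 : #|(\bigcup_(u in A) star u (F u)) :|: star v S| <=
      #|\bigcup_(u in A) star u (F u)| + #|star v S| by exact: leq_card_setU.
  have g3 : #|\bigcup_(u in A) star u (F u)| <= \sum_(u in A) #|pickers pk u|.
    apply: leq_trans (_ : \sum_(u in A) #|star u (F u)| <= _).
      elim/big_rec2: _ => [|u n B uA IH]; first by rewrite cards0.
      by rewrite (leq_trans (leq_card_setU _ _))// leq_add2l.
    by apply: leq_sum => u uA; apply: leq_trans (cstar _ _) (FP u uA).1.
  have g4 := cstar v S; have g5 := subset_leq_card dE.
  have g6 : #|E :\: del| = #|E| - #|A| by rewrite cardsD (setIidPr dE) cdel.
  rewrite cdel in g5; move: sumJ g1 g2 g3 g4 g5 g6; clear; lia.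
have keepG u w : w \in nbr E u -> (u \in A -> w != hd u) -> (w \in A -> u != hd w) ->
    w \in nbr G u.
  rewrite inE => /andP[wu uwE] uA wA; rewrite inE wu inE inE uwE andbT /=.
  apply/orP; left; apply/imsetP => -[a aA /set2_inj[[ua wh]|[uh wa]]].
    by have := uA; rewrite ua => /(_ aA); rewrite wh eqxx.
  by have := wA; rewrite wa => /(_ aA); rewrite uh eqxx.
have starG u B : (star u B \subset G) -> B :\ u \subset nbr G u.
  move=> /subsetP sG; apply/subsetP=> w wB; rewrite inE.
  have := wB; rewrite in_setD1 => /andP[-> _] /=.
  by apply: sG; apply/imsetP; exists w.
have hdJ u w : w \in A -> u = hd w -> w \in pickers pk u by move=> /hdP wA ->; rewrite inE wA.
have covG u : cov u (nbr G u).
  have [uA|uA] := boolP (u \in A).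
    apply: cov_mono (cov_D1 (FP u uA).2); rewrite setDUl subUset starG/=.
      apply/subsetP=> w; rewrite in_setD1 in_setD in_setU negb_or.
      case/and3P=> _ /andP[wD wJ] wE; apply: keepG => // [_|wA].
        by apply: contraNneq wD => ->; apply: hdD.
      by apply: contraNneq wJ; apply: hdJ.
    by rewrite /G; apply/subsetU/orP; right; apply/subsetU/orP; left; apply: (bigcup_sup u).
  have [->|uv] := eqVneq u v.
    apply: cov_mono (cov_D1 cS); rewrite setDUl subUset starG/=; last first.
      by apply/subsetU/orP; right; apply: subsetUr.
    apply/subsetP=> w; rewrite in_setD1 in_setD => /and3P[_ wJ wE].
    apply: keepG => // [|wA]; first by rewrite inE eqxx.
    by apply: contraNneq wJ; apply: hdJ.
  (* A deleted edge at this [u] would be passed by [u] or to [u] by a vertex of [A]; then the picks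
     would climb from [u] to [v]. *)
  apply: cov_mono (covE u); apply/subsetP=> w wE; apply: keepG => // [|wA].
    by rewrite (negbTE uA).
  apply: contraNneq uA => uw; rewrite inE uv.
  move: (wA); rewrite inE => /andP[wv wcl]; have [h] := climbs_step wcl wv.
  by rewrite (hdP _ wA) -uw => -[->].
have wfG e : e \in G -> #|e| = 2.
  rewrite !in_setU in_setD => /orP[/andP[_ /wfE//]|].
  case/orP => [/bigcupP[u _]|]; case/imsetP => w; rewrite in_setD1 => /andP[wu _] ->;
  by rewrite cards2 eq_sym wu.
by have := minE wfG covG; move: cG; lia.
Qed.

Definition owner pk v : {set T} := pickers pk v :|: (D v :\: [set h | pk v == Some h]).

Lemma oriented_owner pk : structure pk -> oriented E (owner pk).
Proof.
move=> [[piD ac] _]; have [DE DE' Da] := oD.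
have JD u v : u \in pickers pk v -> v \in D u by rewrite inE => /eqP; apply: piD.
split=> u v.
- rewrite inE => /orP[/JD/DE|/setDP[/DE//]]; by rewrite nbr_sym.
- move=> uv; rewrite !inE; case/orP: (DE' _ _ uv) => -> /=.
    by rewrite andbT; case: (pk u == Some v); rewrite ?orbT.
  by rewrite andbT; case: (pk v == Some u); rewrite ?orbT.
- rewrite !inE => /orP[vu|/andP[vu vD]].
    rewrite negb_or vu /= andbT; apply/negP => /eqP/piD vD.
    by have := Da _ _ vD; rewrite (piD _ _ (eqP vu)).
  by rewrite negb_or vu (negbTE (Da _ _ vD)) andbF.
Qed.

(** [exchange] bounds the received edges by [#|S|], which suffices if at most 2 edges of [D v] are
    kept. Otherwise [v] keeps 3 and, not being stuck, is not active; hence [S] has more elements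
    than there are received edges. *)
Lemma owner_stable pk v S : structure pk -> pending pk = set0 -> #|D v| <= 3 ->
  cov v (S :|: (nbr E v :\: owner pk v)) -> #|owner pk v| <= #|S| + 2.
Proof.
move=> spi p0 D3 cS.
have JS : #|pickers pk v| <= #|S|.
  apply: exchange spi _; apply: cov_mono cS; apply: setUS; apply: setDS.
  exact: subsetUl.
have le2 : #|D v :\: [set h | pk v == Some h]| <= 2 -> #|owner pk v| <= #|S| + 2.
  by move=> H; apply: leq_trans (leq_card_setU _ _) _; rewrite leq_add.
case pv: (pk v) => [h|].
  apply: le2; have hD : h \in D v by case: spi => -[piD _] _; apply: piD.
  have -> : [set h0 | pk v == Some h0] = [set h].
    by apply/setP=> a; rewrite !inE pv eq_sym.
  by move: D3; rewrite (cardsD1 h) hD.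
have e0 : [set h | pk v == Some h] = set0 by apply/setP=> a; rewrite !inE pv.
have [D2|D2] := leqP #|D v| 2; first by apply: le2; rewrite e0 setD0.
have na : ~~ active pk v.
  by apply/negP => av; have := in_set0 v; rewrite -p0 inE av pv.
have D3' : #|D v| = 3 by apply/eqP; rewrite eqn_leq D3.
have SJ : #|pickers pk v| < #|S|.
  rewrite ltnNge; apply: contra na => SJ; rewrite /active D3' eqxx /=.
  apply/existsP; exists S; rewrite SJ /=.
  by move: cS; rewrite /owner e0 setD0 (setUC (pickers pk v)).
apply: leq_trans (leq_card_setU _ _) _; rewrite e0 setD0 D3'; lia.
Qed.

End Picks.

Import Order.TTheory GRing.Theory Num.Theory.
Local Open Scope ring_scope.

(** * Delaunay graphs *)

Section Delaunay.
Variables (R : realFieldType) (T : finType) (x y : T -> R) (A : {set T}).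
Hypothesis x_inj : {in A &, injective x}.

Definition sqd (a b : R) (s : T) : R := (x s - a) ^+ 2 + (y s - b) ^+ 2.

Definition empty_circle (p q : T) (a b : R) : Prop :=
  sqd a b p = sqd a b q /\ forall s, s \in A -> sqd a b p <= sqd a b s.

(* Two distinct centres make the Voronoi edge nondegenerate; they can be ordered by b since
   the bisector of p and q is not horizontal when x p != x q. *)
Definition delaunay_edge (p q : T) : Prop :=
  exists a1 b1 a2 b2,
    [/\ b1 < b2, empty_circle p q a1 b1 & empty_circle p q a2 b2].

(** Twice the signed area of the triangle; for [x p < x q] it is positive exactly when [s] lies
    above the line [p q]. *)
Definition det (p q s : T) : R :=
  (x q - x p) * (y s - y p) - (y q - y p) * (x s - x p).

Lemma detl p q : det p q p = 0. Proof. by rewrite /det; ring. Qed.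

Lemma detr p q : det p q q = 0. Proof. by rewrite /det; ring. Qed.

Lemma det_swap23 p q s : det p s q = - det p q s.
Proof. by rewrite /det; ring. Qed.

Lemma det_swap13 p q s : det s q p = - det p q s.
Proof. by rewrite /det; ring. Qed.

(* The power of s with respect to a circle, i.e. the height of the lifted point
   (x, y, x^2 + y^2) over a plane. *)
Definition supp (al be ga : R) (s : T) : R :=
  x s ^+ 2 + y s ^+ 2 - al * x s - be * y s - ga.

(** [det a b] is affine: interpolated along the line [p q] at the abscissa of [m], it differs from
    its value at [m] by a multiple of the vertical distance from [m] to that line. *)
Lemma det_interpolate (a b m p q : T) :
  (x q - x m) * det a b p + (x m - x p) * det a b q =
  (x q - x p) * det a b m - (x b - x a) * det p q m.
Proof. rewrite /det; ring. Qed.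

(** Strict convexity of the squared norm: the interior of a chord is strictly inside the circle. *)
Lemma supp_chord al be ga p q m :
  supp al be ga p = 0 -> supp al be ga q = 0 -> det p q m = 0 ->
  x p < x m -> x m < x q -> supp al be ga m < 0.
Proof.
move=> hp hq hm h1 h2.
have dx : 0 < x q - x p by lra.
set t := (x m - x p) / (x q - x p).
have xm : x m = x p + t * (x q - x p) by rewrite /t divfK ?gt_eqF//; ring.
have ym : y m = y p + t * (y q - y p).
  apply: (mulfI (lt0r_neq0 dx)); rewrite /t.
  have -> : (x q - x p) * (y p + (x m - x p) / (x q - x p) * (y q - y p)) =
     (x q - x p) * y p + (x m - x p) * (y q - y p) by field; rewrite gt_eqF.
  by move: hm; rewrite /det => hm; lra.
have t0 : 0 < t by rewrite divr_gt0//; lra.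
have t1 : t < 1 by rewrite ltr_pdivrMr//; lra.
have -> : supp al be ga m = (1 - t) * supp al be ga p + t * supp al be ga q
  - t * (1 - t) * ((x q - x p) ^+ 2 + (y q - y p) ^+ 2).
  by rewrite /supp xm ym; ring.
clearbody t.
have dx2 : 0 < (x q - x p) ^+ 2 by rewrite exprn_gt0.
have dy2 := sqr_ge0 (y q - y p).
have tt : 0 < t * (1 - t) by rewrite mulr_gt0 ?subr_gt0.
by rewrite hp hq !mulr0 !add0r oppr_lt0 mulr_gt0//; lra.
Qed.

(** The circumcircle of the Delaunay face above [p q], with [r] another vertex of the face. The last
    clause makes [p q] a side, not a diagonal, when more than three points are cocircular. *)
Definition top_circle (p q r : T) (al be ga : R) : Prop :=
  [/\ [/\ p \in A, q \in A, r \in A & 0 < det p q r],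
      [/\ supp al be ga p = 0, supp al be ga q = 0 & supp al be ga r = 0],
      forall s, s \in A -> 0 <= supp al be ga s &
      forall s, s \in A -> supp al be ga s = 0 -> 0 <= det p q s].

Definition hull_edge (p q : T) : Prop :=
  [/\ p \in A, q \in A, forall s, s \in A -> det p q s <= 0 &
  exists al be ga,
   [/\ supp al be ga p = 0, supp al be ga q = 0 &
    forall s, s \in A -> 0 <= supp al be ga s]].

Lemma min_ratio (I : finType) (P : pred I) (B K : I -> R) (i0 : I) :
  P i0 -> (forall i, P i -> 0 < K i) ->
  exists2 i, P i & forall j, P j -> B i / K i * K j <= B j.
Proof.
move=> P0 K0; case: (arg_minP (fun i => B i / K i) P0) => i Pi Hi.
by exists i => // j Pj; rewrite -ler_pdivlMr ?K0//; apply: Hi.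
Qed.

(** Only points with [K s > 0] constrain [d]; there [B s > 0], and the least ratio [B s / K s]
    works. *)
Lemma small_step (B K : T -> R) :
  (forall s, s \in A -> 0 <= B s) ->
  (forall s, s \in A -> B s = 0 -> K s <= 0) ->
  exists2 d, 0 < d & forall s, s \in A -> d * K s <= B s.
Proof.
move=> B0 BK.
case: (pickP [pred s | (s \in A) && (0 < K s)]) => [s0 /= P0|none].
  have [|i /andP[iA Ki] Hi] :=
    @min_ratio T [pred s | (s \in A) && (0 < K s)] B K s0 P0.
    by move=> i /andP[].
  have Bi : 0 < B i.
    by rewrite lt_neqAle B0// andbT; apply/eqP => /esym/(BK _ iA); lra.
  exists (B i / K i) => [|s sA]; first by rewrite divr_gt0.
  have [Ks|Ks] := ltP 0 (K s); first by apply: Hi; rewrite /= sA.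
  apply: le_trans (B0 _ sA); rewrite mulr_ge0_le0//.
  by rewrite ltW// divr_gt0.
exists 1 => // s sA; rewrite mul1r; have := none s; rewrite /= sA /= => /negbT.
by rewrite -leNgt => /le_trans; apply; apply: B0.
Qed.

(** The circles through [p] and [q] have powers [h2 - tau * det p q]; raising [tau] moves the centre
    up until a first point above the line is met. Without such a point, [p q] is on the upper
    hull. *)
Lemma edge_top p q : p \in A -> q \in A -> x p < x q -> delaunay_edge p q ->
  hull_edge p q \/ exists r al be ga, top_circle p q r al be ga.
Proof.
move=> pA qA pq [a1 [b1 [a2 [b2 [b12 [e1 E1] [e2 E2]]]]]].
pose h2 s := sqd a2 b2 s - sqd a2 b2 p.
(* The difference of the parameters of the two given circles in this pencil. *)
pose kap := 2 * (b2 - b1) / (x q - x p).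
have dx : 0 < x q - x p by lra.
have kap0 : 0 < kap by rewrite divr_gt0//; lra.
have h1E s : sqd a1 b1 s - sqd a1 b1 p = h2 s + kap * det p q s.
  have Ha : a1 - a2 = - (b1 - b2) * (y q - y p) / (x q - x p).
    apply: (mulIf (lt0r_neq0 dx)); rewrite divfK ?gt_eqF//.
    by move: e1 e2; rewrite /sqd => e1 e2; lra.
  have -> : a1 = a2 - (b1 - b2) * (y q - y p) / (x q - x p) by lra.
  rewrite /h2 /kap /sqd /det; field; by rewrite gt_eqF.
have h20 s : s \in A -> 0 <= h2 s by move=> /E2; rewrite /h2; lra.
have suppE tau : exists al be ga, forall s,
    supp al be ga s = h2 s - tau * det p q s.
  exists (2 * a2 - tau * (y q - y p)), (2 * b2 + tau * (x q - x p)).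
  exists (supp (2 * a2 - tau * (y q - y p)) (2 * b2 + tau * (x q - x p)) 0 p).
  by move=> s; rewrite /supp /h2 /sqd /det; ring.
have h2p : h2 p = 0 by rewrite /h2 subrr.
have h2q : h2 q = 0 by rewrite /h2 e2 subrr.
have dp : det p q p = 0 by rewrite /det; ring.
have dq : det p q q = 0 by rewrite /det; ring.
case: (pickP [pred s | (s \in A) && (0 < det p q s)]) => [s0 /= P0|none].
  have [|r /andP[rA Kr] Hr] :=
    @min_ratio T [pred s | (s \in A) && (0 < det p q s)] h2 (det p q) s0 P0.
    by move=> i /andP[].
  right; pose tau := h2 r / det p q r.
  have tau0 : 0 <= tau by rewrite divr_ge0 ?h20// ltW.
  have [al [be [ga hE]]] := suppE tau.
  exists r, al, be, ga; split; first by split.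
  - split; rewrite hE ?h2p ?h2q ?dp ?dq ?mulr0 ?subrr//.
    by rewrite /tau divfK ?subrr// gt_eqF.
  - move=> s sA; rewrite hE subr_ge0.
    have [Ks|Ks] := ltP 0 (det p q s); first by apply: Hr; rewrite /= sA.
    by apply: le_trans (h20 _ sA); rewrite mulr_ge0_le0.
  (* A cocircular point below the line would lie strictly inside the lower of the two given
     circles. *)
  move=> s sA; rewrite hE => hs0; rewrite leNgt; apply/negP => ds.
  have := E1 _ sA; rewrite -subr_ge0 h1E.
  have -> : h2 s = tau * det p q s by lra.
  rewrite -mulrDl leNgt pmulr_rlt0 ?ds//; lra.
left; split=> // [s sA|].
  by have := none s; rewrite /= sA /= => /negbT; rewrite -leNgt.
have [al [be [ga hE]]] := suppE 0; exists al, be, ga.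
by split=> [||s sA]; rewrite hE mul0r subr0 ?h2p ?h2q ?h20.
Qed.

(** The difference of the powers is affine and vanishes at [m]. It is nonpositive on the chord
    [p q], nonnegative on [p' q'], and both chords pass [m] on the same vertical side; so its [y]
    coefficient is zero, and then its [x] coefficient, as [p] and [q] lie on both sides of [m]. *)
Lemma supp_eq al be ga al' be' ga' m p q p' q' :
  supp al be ga m = 0 -> supp al' be' ga' m = 0 ->
  supp al be ga p = 0 -> supp al be ga q = 0 ->
  supp al' be' ga' p' = 0 -> supp al' be' ga' q' = 0 ->
  0 <= supp al' be' ga' p -> 0 <= supp al' be' ga' q ->
  0 <= supp al be ga p' -> 0 <= supp al be ga q' ->
  x p < x m -> x m < x q -> x p' < x m -> x m < x q' ->
  0 < det p q m * det p' q' m ->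
  forall s, supp al be ga s = supp al' be' ga' s.
Proof.
move=> hm hm' hp hq hp' hq' hp1 hq1 hp1' hq1' pm mq pm' mq' dd.
pose a := al' - al; pose b := be' - be.
have fE s : supp al be ga s - supp al' be' ga' s = a * (x s - x m) + b * (y s - y m).
  by move: hm hm'; rewrite /a /b /supp => hm hm'; lra.
have comb u v : (x v - x m) * (supp al be ga u - supp al' be' ga' u)
   + (x m - x u) * (supp al be ga v - supp al' be' ga' v) = - b * det u v m.
  by rewrite !fE /det; ring.
have c1 := comb p q; have c2 := comb p' q'.
have b1 : 0 <= b * det p q m.
  rewrite -oppr_le0 -mulNr -c1 hp hq !sub0r !mulrN -opprD oppr_le0.
  by rewrite addr_ge0// mulr_ge0//; lra.
have b2 : b * det p' q' m <= 0.
  rewrite -oppr_ge0 -mulNr -c2 hp' hq' !subr0.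
  by rewrite addr_ge0// mulr_ge0//; lra.
have b0 : b = 0.
  apply/eqP; rewrite -sqrf_eq0 eq_le sqr_ge0 andbT -(pmulr_lle0 _ dd).
  have -> : b ^+ 2 * (det p q m * det p' q' m) = (b * det p q m) * (b * det p' q' m) by ring.
  by rewrite mulr_ge0_le0.
have fp := fE p; have fq := fE q; rewrite b0 !mul0r !addr0 in fp fq.
have a0 : a = 0.
  apply/eqP; rewrite eq_le -(nmulr_lle0 a (_ : x p - x m < 0)) ?subr_lt0//.
  rewrite -(pmulr_lle0 a (_ : 0 < x q - x m)) ?subr_gt0//.
  by rewrite -fp -fq hp hq !sub0r !oppr_le0 hp1 hq1.
by move=> s; apply/eqP; rewrite -subr_eq0 fE a0 b0 !mul0r addr0.
Qed.

(* Each edge is charged to the middle vertex of the triangle above it; a triangle has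
   one edge spanning its middle vertex, one to the left and one to the right of it.
   Edges with no point above are charged to their left end. *)
Inductive slot (p q v : T) : nat -> Prop :=
| slot_mid al be ga of top_circle p q v al be ga & x p < x v & x v < x q :
    slot p q v 0
| slot_right r al be ga of v = q & top_circle p q r al be ga & x q < x r :
    slot p q v 1
| slot_left r al be ga of v = p & top_circle p q r al be ga & x r < x p :
    slot p q v 2
| slot_hull of v = p & hull_edge p q : slot p q v 2.

Lemma edge_slot p q : p \in A -> q \in A -> x p < x q -> delaunay_edge p q ->
  exists v (k : 'I_3), v \in A /\ slot p q v k.
Proof.
move=> pA qA pq /(edge_top pA qA pq)[H|[r [al [be [ga H]]]]].
  by exists p, (inord 2); rewrite inordK//; split=> //; apply: slot_hull.
have [[_ _ rA d0] _ _ _] := H.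
have [qr|rq|qr] := ltgtP (x q) (x r).
- by exists q, (inord 1); rewrite inordK//; split=> //; apply: slot_right H qr.
- have [rp|pr|rp] := ltgtP (x r) (x p).
  + by exists p, (inord 2); rewrite inordK//; split=> //; apply: slot_left H rp.
  + by exists r, (inord 0); rewrite inordK//; split=> //; apply: slot_mid H pr rq.
  + by move: d0; rewrite (x_inj rA pA rp) /det !subrr !mulr0 subrr ltxx.
- by move: d0; rewrite (x_inj qA rA qr) /det mulrC subrr ltxx.
Qed.

(** By [supp_eq] the circles coincide. Each chord has the ends of the other on or above it, so an
    end strictly within the other's horizontal span would lie on that chord, against
    [supp_chord]. *)
Lemma slot_mid_inj p q p' q' v al be ga al' be' ga' :
  top_circle p q v al be ga -> x p < x v -> x v < x q ->
  top_circle p' q' v al' be' ga' -> x p' < x v -> x v < x q' ->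
  p = p' /\ q = q'.
Proof.
move=> [[pA qA vA d] [hp hq hv] h0 ht] pv vq.
move=> [[pA' qA' _ d'] [hp' hq' hv'] h0' ht'] pv' vq'.
have hE := supp_eq hv hv' hp hq hp' hq' (h0' _ pA) (h0' _ qA) (h0 _ pA') (h0 _ qA')
  pv vq pv' vq' (mulr_gt0 d d').
have nomid p1 q1 p2 q2 m : x p2 < x q2 ->
   supp al be ga p1 = 0 -> supp al be ga q1 = 0 -> supp al be ga m = 0 ->
   0 <= det p1 q1 m -> 0 <= det p2 q2 p1 -> 0 <= det p2 q2 q1 ->
   det p2 q2 m = 0 -> x p1 < x m -> x m < x q1 -> False.
  move=> pq2 z1 z2 z3 d1 d2 d3 d4 l1 l2.
  have d0 : det p1 q1 m = 0.
    have := det_interpolate p2 q2 m p1 q1; rewrite d4 mulr0 sub0r => I.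
    have : 0 <= (x q1 - x m) * det p2 q2 p1 + (x m - x p1) * det p2 q2 q1.
      by rewrite addr_ge0// mulr_ge0// subr_ge0 ltW.
    rewrite I oppr_ge0 pmulr_rle0 ?subr_gt0// => d5.
    by apply/eqP; rewrite eq_le d5.
  by have := supp_chord z1 z2 d0 l1 l2; rewrite z3 ltxx.
have pq := lt_trans pv vq; have pq' := lt_trans pv' vq'.
have zp' : supp al be ga p' = 0 by rewrite hE.
have zq' : supp al be ga q' = 0 by rewrite hE.
have e1 := ht _ pA' zp'; have e2 := ht _ qA' zq'.
have e3 : 0 <= det p' q' p by apply: ht' => //; rewrite -hE.
have e4 : 0 <= det p' q' q by apply: ht' => //; rewrite -hE.
split.
- case: (ltgtP (x p) (x p')) => [lt|lt|/x_inj->//]; exfalso.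
  + by apply: (@nomid p q p' q' p'); rewrite ?detl// (lt_trans pv').
  + by apply: (@nomid p' q' p q p); rewrite ?detl// (lt_trans pv).
- case: (ltgtP (x q) (x q')) => [lt|lt|/x_inj->//]; exfalso.
  + by apply: (@nomid p' q' p q q); rewrite ?detr// (lt_trans pv').
  + by apply: (@nomid p q p' q' q'); rewrite ?detr// (lt_trans pv).
Qed.

(** [q] is below the chords [p r] and [p' r'], so [supp_eq] applies to them; the side conditions
    then make [p], [p'] and [q] collinear. *)
Lemma slot_right_inj p p' q r r' al be ga al' be' ga' :
  x p < x q -> x p' < x q ->
  top_circle p q r al be ga -> x q < x r ->
  top_circle p' q r' al' be' ga' -> x q < x r' -> p = p'.
Proof.
move=> pq pq' [[pA qA rA d] [hp hq hr] h0 ht] qr.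
move=> [[pA' _ rA' d'] [hp' hq' hr'] h0' ht'] qr'.
have hE : forall s, supp al be ga s = supp al' be' ga' s.
  apply: (supp_eq hq hq' hp hr hp' hr') => //; try exact: h0; try exact: h0'.
  by rewrite !(det_swap23 _ q) mulrNN mulr_gt0.
have zp' : supp al be ga p' = 0 by rewrite hE.
have e1 := ht _ pA' zp'.
have e2 : 0 <= det p' q p by apply: ht' => //; rewrite -hE.
have d0 : det p q p' = 0.
  by apply/eqP; rewrite eq_le e1 andbT -oppr_ge0 -det_swap13.
case: (ltgtP (x p) (x p')) => [lt|lt|/x_inj->//].
  by have := supp_chord hp hq d0 lt pq'; rewrite zp' ltxx.
by have := supp_chord zp' hq _ lt pq; rewrite det_swap13 d0 oppr0 hp ltxx => /(_ erefl).
Qed.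

Lemma slot_left_inj p q q' r r' al be ga al' be' ga' :
  x p < x q -> x p < x q' ->
  top_circle p q r al be ga -> x r < x p ->
  top_circle p q' r' al' be' ga' -> x r' < x p -> q = q'.
Proof.
move=> pq pq' [[pA qA rA d] [hp hq hr] h0 ht] rp.
move=> [[_ qA' rA' d'] [hp' hq' hr'] h0' ht'] rp'.
have hE : forall s, supp al be ga s = supp al' be' ga' s.
  apply: (supp_eq hp hp' hr hq hr' hq') => //; try exact: h0; try exact: h0'.
  by rewrite !(det_swap13 p) mulrNN mulr_gt0.
have zq' : supp al be ga q' = 0 by rewrite hE.
have e1 := ht _ qA' zq'.
have e2 : 0 <= det p q' q by apply: ht' => //; rewrite -hE.
have d0 : det p q q' = 0.
  by apply/eqP; rewrite eq_le e1 andbT -oppr_ge0 -det_swap23.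
case: (ltgtP (x q) (x q')) => [lt|lt|/x_inj->//].
  by have := supp_chord hp zq' _ pq lt; rewrite det_swap23 d0 oppr0 hq ltxx => /(_ erefl).
by have := supp_chord hp hq d0 pq' lt; rewrite zq' ltxx.
Qed.

(** The triangle puts [p] below the chord [r q], whereas [r] and [q] lie on or below the hull line
    through [p]. *)
Lemma slot_left_hull p q q' r al be ga : x p < x q' -> x p < x q ->
  top_circle p q r al be ga -> x r < x p -> hull_edge p q' -> False.
Proof.
move=> pq' pq [[pA qA rA d] _ _ _] rp [_ _ H _].
have := det_interpolate p q' p r q; rewrite detl mulr0 sub0r => I.
have : (x q - x p) * det p q' r + (x p - x r) * det p q' q <= 0.
  by rewrite -oppr_ge0 opprD -!mulrN addr_ge0// mulr_ge0 ?oppr_ge0 ?H//; lra.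
rewrite I oppr_le0 pmulr_rge0 ?subr_gt0// leNgt => /negP; apply.
by move: d; rewrite /det; lra.
Qed.

Lemma hull_inj p q q' : x p < x q -> x p < x q' ->
  hull_edge p q -> hull_edge p q' -> q = q'.
Proof.
move=> pq pq' [_ qA H [al [be [ga [hp hq h0]]]]] [_ qA' H' [al' [be' [ga' [hp' hq' h0']]]]].
have d0 : det p q q' = 0.
  by apply/eqP; rewrite eq_le H//= -oppr_le0 -det_swap23 H'.
case: (ltgtP (x q) (x q')) => [lt|lt|/x_inj->//].
  have := supp_chord hp' hq' _ pq lt; rewrite det_swap23 d0 oppr0 => /(_ erefl).
  by rewrite ltNge h0'.
by have := supp_chord hp hq d0 pq' lt; rewrite ltNge h0.
Qed.

Lemma slot_inj p q p' q' v k : x p < x q -> x p' < x q' ->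
  slot p q v k -> slot p' q' v k -> p = p' /\ q = q'.
Proof.
move=> pq pq' [al be ga C l1 l2|r al be ga e C l|r al be ga e C l|e C] S;
  inversion S as [al' be' ga' C' l1' l2'|r' al' be' ga' e' C' l'
    |r' al' be' ga' e' C' l'|e' C']; subst.
- exact: slot_mid_inj C l1 l2 C' l1' l2'.
- split=> //; exact: slot_right_inj pq pq' C l C' l'.
- split=> //; exact: slot_left_inj pq pq' C l C' l'.
- by have := slot_left_hull pq' pq C l C'.
- by have := slot_left_hull pq pq' C' l' C.
- split=> //; exact: hull_inj pq pq' C C'.
Qed.

Definition delaunay_arc (e : T * T) : bool :=
  [&& e.1 \in A, e.2 \in A, x e.1 < x e.2 & `[< delaunay_edge e.1 e.2 >]].

Lemma card_delaunay_arc : A != set0 -> (#|[set e | delaunay_arc e]| < 3 * #|A|)%N.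
Proof.
case/set0Pn => a0 a0A.
have [a aA amin] : exists2 a, a \in A & forall b, b \in A -> x a <= x b.
  by case: (arg_minP x a0A) => a ? ?; exists a.
have H e : exists vk : T * 'I_3, delaunay_arc e -> vk.1 \in A /\ slot e.1 e.2 vk.1 vk.2.
  case: (boolP (delaunay_arc e)) => [|_]; last by exists (a, ord0).
  case/and4P=> e1 e2 e12 /asboolP ee; have [v [k vk]] := edge_slot e1 e2 e12 ee.
  by exists (v, k).
have [f fP] := choice H.
have f_inj : {in [set e | delaunay_arc e] &, injective f}.
  move=> [p q] [p' q']; rewrite !inE => E E' ff.
  have [_ S] := fP _ E; have [_ S'] := fP _ E'; rewrite -ff /= in S'.
  case/and4P: E => _ _ E _; case/and4P: E' => _ _ E' _.
  by have [/= -> ->] := slot_inj E E' S S'.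
rewrite -(card_in_imset f_inj).
have -> : (3 * #|A| = #|setX A [set: 'I_3]|)%N by rewrite cardsX cardsT card_ord mulnC.
apply: proper_card; apply/properP; split.
  apply/subsetP=> _ /imsetP[e eF ->]; have E : delaunay_arc e by rewrite inE in eF.
  by rewrite !inE (fP e E).1.
(* Slot 0 of the leftmost point is free, which makes the bound strict. *)
exists (a, ord0); first by rewrite !inE aA.
apply/negP => /imsetP[e]; rewrite inE => E Ef.
have [_] := fP e E; rewrite -Ef /= => S; case/and4P: E => e1 _ _ _.
by inversion S as [al be ga C l1 l2| | |]; move: (amin _ e1); rewrite leNgt l1.
Qed.

(** * Delaunay neighbours closer to a target *)

Lemma delaunay_edge_sym p q : delaunay_edge p q -> delaunay_edge q p.
Proof.
move=> [a1 [b1 [a2 [b2 [b12 [e1 E1] [e2 E2]]]]]]; exists a1, b1, a2, b2.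
by split=> //; split; rewrite -?e1 -?e2.
Qed.

(** On the way from [u] to the target [(a, b)] one leaves the Voronoi cell of [u], as [v] is closer
    to the target; the wall at the exit gives [v']. *)
Lemma delaunay_cover u v a b : u \in A -> v \in A -> sqd a b v < sqd a b u ->
  exists v', [/\ v' \in A, v' != u, delaunay_edge u v' & sqd a b v' < sqd a b u].
Proof.
move=> uA vA vu.
pose e1 := a - x u; pose e2 := b - y u.
pose N s := (x s - x u) ^+ 2 + (y s - y u) ^+ 2.
pose P s := e1 * (x s - x u) + e2 * (y s - y u).
pose Q s := e1 * (y s - y u) - e2 * (x s - x u).
have N0 s : 0 <= N s by rewrite addr_ge0 ?sqr_ge0.
have sqdE t d s : sqd (x u + t * e1 - d * e2) (y u + t * e2 + d * e1) s -
   sqd (x u + t * e1 - d * e2) (y u + t * e2 + d * e1) u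
   = N s - 2 * t * P s - 2 * d * Q s.
  by rewrite /sqd /N /P /Q; ring.
have closerE s : (sqd a b s < sqd a b u) = (N s < 2 * P s).
  have := sqdE 1 0 s; rewrite !mul1r !mul0r !subr0 !addr0 mulr0 mul0r subr0 mulr1.
  by rewrite /e1 /e2 !subrKC => h; rewrite -subr_lt0 h subr_lt0.
have Pv : 0 < P v by move: vu; rewrite closerE; have := N0 v; lra.
(* The time at which the ray meets the bisector of [u] and [s]; the target is reached at time 1. *)
pose tau s := N s / (2 * P s).
have [v0 Pv0 v0min] : exists2 v0, (v0 \in A) && (0 < P v0) &
    forall s, (s \in A) && (0 < P s) -> tau v0 <= tau s.
  have P0 : [pred s | (s \in A) && (0 < P s)] v by rewrite /= vA.
  by case: (arg_minP tau P0) => v0 ? ?; exists v0.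
pose s0 := tau v0.
(* Among the bisectors met first by the ray from u to the target, take the one that
   bounds the Voronoi cell of u on one side of the exit point. *)
have [v1 /and3P[v1A Pv1 /eqP tv1] v1max] :
    exists2 v1, [&& v1 \in A, 0 < P v1 & tau v1 == s0] &
    forall s, [&& s \in A, 0 < P s & tau s == s0] -> Q s / P s <= Q v1 / P v1.
  have P0 : [pred s | [&& s \in A, 0 < P s & tau s == s0]] v0.
    by rewrite /= eqxx andbT.
  by case: (arg_maxP (fun s => Q s / P s) P0) => v1 ? ?; exists v1.
pose m := Q v1 / P v1.
have s00 : 0 <= s0 by rewrite /s0 divr_ge0// mulr_ge0// ltW//; case/andP: Pv0.
have NE s : 0 < P s -> N s = tau s * (2 * P s).
  by move=> Ps; rewrite /tau divfK// gt_eqF// mulr_gt0.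
pose B s := N s - 2 * s0 * P s.
have B0 s : s \in A -> 0 <= B s.
  move=> sA; rewrite /B; have [Ps|Ps] := ltP 0 (P s).
    rewrite (NE s Ps) (_ : _ - _ = 2 * ((tau s - s0) * P s)); last by ring.
    by rewrite mulr_ge0// mulr_ge0 ?subr_ge0 ?v0min ?sA// ltW.
  rewrite subr_ge0; apply: le_trans (N0 s); rewrite mulr_ge0_le0// mulr_ge0//.
have Nu s : s \in A -> N s = 0 -> s = u.
  move=> sA /eqP; rewrite paddr_eq0 ?sqr_ge0// !sqrf_eq0 => /andP[/eqP h _].
  by apply: x_inj => //; lra.
(* Moving the centre along the bisector of [u] and [v1] lowers the slack [B s] by a multiple of
   [Q s - m * P s], nonpositive where the slack is zero; so a short move keeps the circle empty. *)
have [d d0 dP] : exists2 d, 0 < d &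
    forall s, s \in A -> d * (2 * (Q s - m * P s)) <= B s.
  apply: small_step => // s sA Bs.
  have [->|su] := eqVneq s u; first by rewrite /P /Q !subrr !mulr0; lra.
  have Ps : 0 < P s.
    rewrite ltNge; apply/negP => Ps; move/eqP: su; apply; apply: Nu => //.
    have : 2 * s0 * P s <= 0 by rewrite mulr_ge0_le0// mulr_ge0.
    by move: (N0 s) Bs; rewrite /B; lra.
  have ts : tau s == s0.
    have : N s = s0 * (2 * P s) by move: Bs; rewrite /B; lra.
    by rewrite /tau => ->; rewrite mulfK// gt_eqF// mulr_gt0.
  have := v1max s; rewrite sA Ps ts => /(_ isT); rewrite -/m ler_pdivrMr//; lra.
have Bv1 : B v1 = 0 by rewrite /B (NE _ Pv1) tv1; ring.
have Kv1 : Q v1 - m * P v1 = 0 by rewrite /m divfK ?subrr// gt_eqF.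
have v1u : v1 != u by apply/eqP => h; move: Pv1; rewrite h /P !subrr !mulr0 addr0 ltxx.
have circ t' d' : (forall s, s \in A -> 0 <= N s - 2 * t' * P s - 2 * d' * Q s) ->
    N v1 - 2 * t' * P v1 - 2 * d' * Q v1 = 0 ->
    empty_circle u v1 (x u + t' * e1 - d' * e2) (y u + t' * e2 + d' * e1).
  move=> h1 h2; split; first by apply/eqP; rewrite eq_sym -subr_eq0 sqdE h2.
  by move=> s /h1; rewrite -sqdE subr_ge0.
have C1 : empty_circle u v1 (x u + s0 * e1 - 0 * e2) (y u + s0 * e2 + 0 * e1).
  by apply: circ => [s sA|]; rewrite mulr0 mul0r subr0; [exact: B0|exact: Bv1].
have C2 : empty_circle u v1 (x u + (s0 - d * m) * e1 - d * e2)
    (y u + (s0 - d * m) * e2 + d * e1).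
  apply: circ => [s sA|].
    by move: (dP s sA); rewrite /B; lra.
  by move: Bv1; rewrite /B (_ : Q v1 = m * P v1); lra.
have v1c : sqd a b v1 < sqd a b u.
  rewrite closerE (NE _ Pv1) tv1 gtr_pMl ?mulr_gt0//.
  apply: le_lt_trans (v0min v _) _; first by rewrite vA.
  by rewrite ltr_pdivrMr ?mulr_gt0// mul1r -closerE.
exists v1; split=> //.
have e0 : 0 < e1 ^+ 2 + e2 ^+ 2.
  rewrite lt_neqAle addr_ge0 ?sqr_ge0// andbT eq_sym paddr_eq0 ?sqr_ge0//.
  rewrite !sqrf_eq0; apply/negP => /andP[/eqP h1 /eqP h2].
  by move: Pv1; rewrite /P h1 h2 !mul0r addr0 ltxx.
(* Centres of equal height would make the bisector horizontal, hence [x v1 = x u]. *)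
have bne : y u + s0 * e2 + 0 * e1 != y u + (s0 - d * m) * e2 + d * e1.
  apply/eqP => h; have h2 : d * (e1 - m * e2) = 0 by lra.
  have {}h2 : e1 = m * e2.
    by move/eqP: h2; rewrite mulf_eq0 gt_eqF//= subr_eq0 => /eqP.
  have dxv : x v1 - x u != 0.
    by rewrite subr_eq0; apply: contra v1u => /eqP/x_inj->.
  have : (e2 + m * e1) * (x v1 - x u) = 0.
    by move: Kv1; rewrite /Q /P h2; lra.
  move/eqP; rewrite mulf_eq0 (negbTE dxv) orbF h2 => /eqP h3.
  have : e2 * (1 + m ^+ 2) = 0 by rewrite -h3; ring.
  move/eqP; rewrite mulf_eq0 (gt_eqF (_ : 0 < 1 + m ^+ 2)) ?orbF; last first.
    by have := sqr_ge0 m; lra.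
  by move/eqP => h4; move: e0; rewrite h2 h4 mulr0 expr0n addr0 ltxx.
by move: bne; rewrite neq_lt => /orP[] lt; do 4!eexists; split; first [exact: lt|eassumption].
Qed.

End Delaunay.

(** * Generic coordinates *)

Lemma exists_not_root (R : realFieldType) (p : {poly R}) : p != 0 -> exists a, ~~ root p a.
Proof.
move=> p0; pose s : seq R := [seq n%:R | n <- iota 0 (size p)].
have us : uniq s by rewrite map_inj_uniq ?iota_uniq//; apply: mulrIn; rewrite oner_eq0.
have [all_r|/allPn[a _ ra]] := boolP (all (root p) s); last by exists a.
by have := max_poly_roots p0 all_r us; rewrite size_map size_iota ltnn.
Qed.

(** A pair of distinct points excludes only the roots [e] of a nonzero polynomial of degree at most
    1. *)
Lemma generic_direction (R : realFieldType) (T : finType) (pos : T -> R * R) :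
  injective pos -> exists e, injective (fun s => (pos s).1 + e * (pos s).2).
Proof.
move=> pos_inj.
pose q (i : T * T) : {poly R} :=
  ((pos i.1).1 - (pos i.2).1)%:P + ((pos i.1).2 - (pos i.2).2)%:P * 'X.
have q0 i : i.1 != i.2 -> q i != 0.
  apply: contraNneq => qi; have c0 : (q i)`_0 = 0 by rewrite qi coef0.
  have c1 : (q i)`_1 = 0 by rewrite qi coef0.
  move: c0 c1; rewrite /q !coefD !coefCM !coefX !coefC /= mulr0 addr0 mulr1 add0r.
  move=> /subr0_eq c0 /subr0_eq c1; apply/eqP/pos_inj.
  by rewrite [LHS]surjective_pairing [RHS]surjective_pairing c0 c1.
have [|e ne] := @exists_not_root R (\prod_(i | i.1 != i.2) q i).
  by apply/prodf_neq0 => i; apply: q0.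
exists e => s t st; apply/eqP; apply: contraNT ne => nst.
rewrite /root horner_prod; apply/prodf_eq0; exists (s, t) => //=.
by rewrite /q !hornerE /=; apply/eqP; lra.
Qed.

(** * Greedy connectivity as a covering condition *)

Section Greedy.
Variables (R : realType) (T : finType) (pos : T -> R * R).

Lemma edist_lt u v w : (edist pos v w < edist pos u w) =
  (((pos v).1 - (pos w).1) ^+ 2 + ((pos v).2 - (pos w).2) ^+ 2 <
   ((pos u).1 - (pos w).1) ^+ 2 + ((pos u).2 - (pos w).2) ^+ 2).
Proof. by rewrite /edist ltNge ler_sqrt -?ltNge// addr_ge0 ?sqr_ge0. Qed.

Lemma delaunay_graph (A : {set T}) : injective pos -> A != set0 ->
  exists F : {set {set T}},
    [/\ forall e, e \in F -> #|e| = 2%N, (#|F| < 3 * #|A|)%N &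
     forall u v w, u \in A -> v \in A -> edist pos v w < edist pos u w ->
       exists v', [/\ v' != u, [set u; v'] \in F & edist pos v' w < edist pos u w]].
Proof.
move=> pos_inj A0; have [e e_inj] := generic_direction pos_inj.
(* A rotation with scaling by the root of [1 + e ^+ 2], so comparisons of distances are
   preserved. *)
pose x s := (pos s).1 + e * (pos s).2; pose y s := (pos s).2 - e * (pos s).1.
have x_inj : {in A &, injective x} by move=> s t _ _; apply: e_inj.
have e0 : 0 < 1 + e ^+ 2 by have := sqr_ge0 e; lra.
have sqdE u v w : (sqd x y (x w) (y w) v < sqd x y (x w) (y w) u) =
    (edist pos v w < edist pos u w).
  rewrite edist_lt -[RHS](ltr_pM2l e0) /sqd /x /y.
  by congr (_ < _); ring.
exists [set [set i.1; i.2] | i in [set i | delaunay_arc x y A i]]; split.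
- move=> _ /imsetP[i iF ->]; have {iF} : delaunay_arc x y A i by rewrite inE in iF.
  case/and4P=> _ _ lt _; rewrite cards2; case: eqP lt => // ->; by rewrite ltxx.
- apply: leq_ltn_trans (leq_imset_card _ _) _; exact: card_delaunay_arc.
move=> u v w uA vA; rewrite -sqdE => lt.
have [v' [v'A v'u uv' lt']] := delaunay_cover x_inj uA vA lt.
exists v'; split=> //; last by rewrite -sqdE.
have [xl|xl|/x_inj e'] := ltgtP (x u) (x v').
- apply/imsetP; exists (u, v') => //.
  by rewrite inE /delaunay_arc /= uA v'A xl; apply/asboolP.
- apply/imsetP; exists (v', u); last by rewrite setUC.
  by rewrite inE /delaunay_arc /= uA v'A xl; apply/asboolP/delaunay_edge_sym.
- by rewrite e' ?eqxx in v'u.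
Qed.

Definition covers (u : T) (N : {set T}) : bool :=
  `[< forall w, w != u -> exists2 v, v \in N & edist pos v w < edist pos u w >].

Lemma covers_mono u (A B : {set T}) : A \subset B -> covers u A -> covers u B.
Proof.
move=> /subsetP AB /asboolP cA; apply/asboolP => w /cA[v vA lt].
by exists v => //; apply: AB.
Qed.

Lemma covers_D1 u (A : {set T}) : covers u A -> covers u (A :\ u).
Proof.
move=> /asboolP cA; apply/asboolP => w /cA[v vA lt]; exists v => //.
by rewrite in_setD1 vA andbT; apply: contraTneq lt => ->; rewrite ltxx.
Qed.

Lemma greedy_covers (adj : rel T) u :
  greedy_connected pos adj u -> covers u [set v | adj u v].
Proof.
move=> gu; apply/asboolP => w wu; have [[|v s] /= []] := gu _ wu.
  by move=> _ uw; rewrite uw eqxx in wu.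
by case/andP=> /andP[uv lt] _ _; exists v; rewrite ?inE.
Qed.

Lemma covers_greedy (adj : rel T) :
  (forall u, covers u [set v | adj u v]) -> forall u, greedy_connected pos adj u.
Proof.
move=> ca u w _.
(* Each greedy step shrinks this set, which drives the induction. *)
pose near u := [set v | edist pos v w < edist pos u w].
have [n] := ubnP #|near u|; elim: n u => // n IH u un.
have [<-|wu] := eqVneq w u; first by exists [::].
have /asboolP/(_ w wu)[v] := ca u; rewrite inE => uv lt.
have [|s [sp sl]] := IH v.
  rewrite ltnS in un; apply: leq_trans un; apply: proper_card; apply/properP; split.
    by apply/subsetP => a; rewrite !inE => /lt_trans; apply.
  by exists v; rewrite !inE ?ltxx.
by exists (v :: s); rewrite /= uv lt.
Qed.

Lemma nbr_adjE (E : {set {set T}}) u : nbr E u = [set v | adjE E u v].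
Proof. by apply/setP=> v; rewrite !inE /adjE eq_sym. Qed.

End Greedy.

(** * Sparsity of the optimum and the equilibrium *)

Lemma social_optimum_sparse (R : realType) (T : finType) (pos : T -> R * R)
  (E : {set {set T}}) (X : {set T}) : injective pos -> social_optimum pos E ->
  X != set0 -> (#|induced E X| < 3 * #|X|)%N.
Proof.
move=> pos_inj [wfE gE minE] X0.
have [F [wfF cF dF]] := delaunay_graph pos_inj X0.
apply: leq_ltn_trans cF.
have sE : induced E X \subset E by apply/subsetP => e; rewrite inE => /andP[].
pose E' := (E :\: induced E X) :|: F.
suff : (#|E| <= #|E'|)%N.
  have : (#|E'| <= #|E :\: induced E X| + #|F|)%N by exact: leq_card_setU.
  rewrite cardsD (setIidPr sE); have := subset_leq_card sE; lia.
apply: minE.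
  by move=> e; rewrite !inE => /orP[/andP[_ /wfE]|/wfF].
apply: covers_greedy => u; apply/asboolP => w wu.
have /asboolP/(_ w wu)[v] := greedy_covers (gE u); rewrite inE => /andP[uv uvE] lt.
have [/andP[uX vX]|nX] := boolP ((u \in X) && (v \in X)).
  have [v' [v'u uv' lt']] := dF _ _ _ uX vX lt.
  by exists v' => //; rewrite inE /adjE eq_sym v'u inE uv' orbT.
exists v => //; rewrite inE /adjE uv inE in_setD uvE andbT; apply/orP; left.
by rewrite inE uvE subUset !sub1set.
Qed.

Theorem mainTheorem17 (R : realType) (T : finType) (pos : T -> R * R)
  (pos_inj : injective pos) (E : {set {set T}}) :
  social_optimum pos E ->
  exists s : T -> {set T},
    [/\ valid_profile s,
        (forall u v, u != v -> ([set u; v] \in E) = netP s u v),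
        (forall u v, ~~ ((v \in s u) && (u \in s v))) &
        additive_NE pos 2 s].
Proof.
move=> opt; have sparse X := @social_optimum_sparse R T pos E X pos_inj opt.
have [wfE gE minE] := opt.
have [D oD D3] := oriented_le3 sparse.
have covE u : covers pos u (nbr E u) by rewrite nbr_adjE; apply: greedy_covers.
have minE' (E' : {set {set T}}) : (forall e, e \in E' -> #|e| = 2%N) ->
    (forall u, covers pos u (nbr E' u)) -> (#|E| <= #|E'|)%N.
  move=> wfE' cE'; apply: minE => // u.
  by apply: covers_greedy => v; rewrite -nbr_adjE.
have [pi spi p0] := exists_complete (@covers_mono _ _ pos) oD sparse.
have oO := oriented_owner oD spi.
pose s := owner D pi; have [sE sE' sa] := oO.
have netE u v : netP s u v = (v \in nbr E u).
  apply/idP/idP; last exact: sE'.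
  by case/orP => /sE //; rewrite nbr_sym.
exists s; split.
- by move=> u; apply/negP => /sE; rewrite inE eqxx.
- by move=> u v uv; rewrite netE inE eq_sym uv.
- by move=> u v; apply/negP => /andP[/sa/negP].
move=> u S uS; rewrite /strictly_better.
have -> : cost pos s u = Some #|s u|.
  rewrite /cost; case: asboolP => // -[]; apply: covers_greedy => v.
  by apply: covers_mono (covE v); apply/subsetP=> a; rewrite inE netE.
rewrite {1}/cost; case: asboolP => [/greedy_covers cS|_ []].
rewrite ltrBrDr -natrD ltr_nat; apply/negP; rewrite -leqNgt.
apply: (owner_stable (cov := covers pos) (E := E)) => //.
- exact: covers_mono.
- exact: covers_D1.
apply: covers_mono cS; apply/subsetP=> v; rewrite inE /netP /update eqxx => /orP[vS|].
  by rewrite inE vS.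
case: eqP => [->|vu uv]; first by rewrite (negbTE (uS : u \notin S)).
by rewrite in_setU in_setD (sa _ _ uv) nbr_sym (sE _ _ uv) orbT.
Qed.
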